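(* Let $p\ge 1$ and let $U^p(\Gamma)$ be an $H^1$-conforming polynomial basis on the reference triangle $\Gamma$, split into vertex, edge and cell base functions $\mathcal V^p_i$, $\mathcal E^p_j$, $\mathcal C^p_{123}$. Consider the template $\mathcal T=\{\mathcal T_1,\mathcal T_2,\mathcal T_3,\mathcal T_{12},\mathcal T_{13},\mathcal T_{23},\mathcal T_{123}\}$ with $$\mathcal T_1=\{\mathbf e_1,\mathbf e_2\},\quad \mathcal T_2=\{\mathbf e_1+\mathbf e_2,\mathbf e_1\},\quad \mathcal T_3=\{\mathbf e_1+\mathbf e_2,-\mathbf e_2\},$$ $$\mathcal T_{12}=\{\mathbf e_2,-\mathbf e_1\},\quad \mathcal T_{13}=\{\mathbf e_1,\mathbf e_2\},\quad \mathcal T_{23}=\{\tfrac12(\mathbf e_1-\mathbf e_2),\mathbf e_1+\mathbf e_2\},\quad \mathcal T_{123}=\{\mathbf e_1,\mathbf e_2\}.$$ Then the tensor product of the template with the basis, $$\Big\{\bigoplus_{i=1}^3\mathcal V^p_i\otimes\mathcal T_i\Big\}\oplus\Big\{\bigoplus_{j\in\mathcal J}\mathcal E^p_j\otimes\mathcal T_j\Big\}\oplus\{\mathcal C^p_{123}\otimes\mathcal T_{123}\},\qquad \mathcal J=\{(1,2),(1,3),(2,3)\},$$ yields a unisolvent Nédélec element of the second type $\mathcal N_{II}^p(\Gamma)$.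
   Context: $\Gamma=\{(\xi,\eta)\in[0,1]^2 \mid \xi+\eta\le 1\}$ has vertices $v_1=(0,0)$, $v_2=(0,1)$, $v_3=(1,0)$, edges $e_{12},e_{13},e_{23}$ ($e_{ij}$ joins $v_i$ and $v_j$) and cell $c_{123}$ (its interior). $\mathbf e_1,\mathbf e_2$ is the Cartesian basis of $\mathbb R^2$. $P^p(\Gamma)$ denotes the polynomials of total degree at most $p$. $H^1$-conforming polynomial basis $U^p(\Gamma)$: linearly independent (unisolvent) polynomials in $P^p(\Gamma)$ with $\dim U^p(\Gamma)=\dim P^p(\Gamma)=(p+2)(p+1)/2$, each associated with one polytope: one vertex base function for each vertex ($\mathcal V^p_i$, dimension $1$), $p-1$ edge base functions for each edge ($\mathcal E^p_j$), and $(p-2)(p-1)/2$ cell base functions ($\mathcal C^p_{123}$). A vertex base function vanishes at all other vertices and on the non-neighbouring edge; an edge base function vanishes on all other edges; a cell base function vanishes on the whole boundary. For a set of scalar base functions $\mathcal S$ and a set of vectors $\mathcal T_\ast$, $\mathcal S\otimes\mathcal T_\ast$ denotes all products $n\,\boldsymbol\ell$ with $n\in\mathcal S$, $\boldsymbol\ell\in\mathcal T_\ast$. ''Unisolvent Nédélec element of the second type'' means: the vectorial base functions so obtained are linearly independent and form a basis of the Nédélec space of the second type, whose polynomial space on $\Gamma$ is $[P^p(\Gamma)]^2$. *)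

(* Defs.v *)
From HB Require Import structures.
From mathcomp Require Import all_boot all_order all_algebra.
From mathcomp Require Import reals.
From mathcomp Require Import mpoly zify.

Set Implicit Arguments.
Unset Strict Implicit.
Unset Printing Implicit Defensive.

Import Order.TTheory GRing.Theory Num.Theory.
Local Open Scope ring_scope.

(* Polynomials on the triangle are formal bivariate polynomials: since the    *)
(* triangle has nonempty interior, they are determined by their values on it. *)
(* All indices are shifted by one: vertex v_(i+1) is indexed by i : 'I_3, and *)
(* the basis vector e_(k+1) of the plane by k : 'I_2.                         *)

Section LinearAlgebra.
Variables (R : realType) (V : lmodType R) (I : finType).

Definition lin_indep (f : I -> V) : Prop :=
  forall c : I -> R, \sum_i c i *: f i = 0 -> forall i, c i = 0.

Definition spans (W : V -> Prop) (f : I -> V) : Prop :=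
  forall v, W v -> exists c : I -> R, v = \sum_i c i *: f i.

Definition basis_of (W : V -> Prop) (f : I -> V) : Prop :=
  [/\ forall i, W (f i), lin_indep f & spans W f].

End LinearAlgebra.

Section Triangle.
Variable R : realType.

Definition e1 : 'rV[R]_2 := delta_mx 0 0.
Definition e2 : 'rV[R]_2 := delta_mx 0 1.

Definition vertex (i : 'I_3) : 'rV[R]_2 := tnth [tuple 0; e2; e1] i.

Definition edge : finType := {e : 'I_3 * 'I_3 | (e.1 < e.2)%N}.

(* edges are closed, i.e. they contain their two end points *)
Definition on_edge (e : edge) (x : 'rV[R]_2) : Prop :=
  exists2 t : R, 0 <= t <= 1 &
    x = (1 - t) *: vertex (val e).1 + t *: vertex (val e).2.

Definition neighbour (i : 'I_3) (e : edge) : bool :=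
  (i == (val e).1) || (i == (val e).2).

Definition eval (q : {mpoly R[2]}) (x : 'rV[R]_2) : R := q.@[fun k => x 0 k].

Definition vanishes_on (q : {mpoly R[2]}) (S : 'rV[R]_2 -> Prop) : Prop :=
  forall x, S x -> eval q x = 0.

(* msize is the total degree plus one, and 0 for the zero polynomial *)
Definition Pspace (p : nat) (q : {mpoly R[2]}) : Prop := (msize q <= p.+1)%N.

End Triangle.

(* The number of cell functions is (p-2)(p-1)/2; the truncated predecessors   *)
(* give 0 for p = 1.                                                          *)
Definition ncell (p : nat) : nat := (p.-2 * p.-1)./2.

Definition base_idx (p : nat) : finType :=
  ('I_3 + edge * 'I_p.-1 + 'I_(ncell p))%type.

Lemma card_edge : #|{: edge}| = 3.
Proof.
rewrite card_sig -sum1_card.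
transitivity (\sum_(i < 3) \sum_(j < 3 | i < j) 1)%N.
  by rewrite pair_big_dep; apply: eq_bigl.
by rewrite !big_ord_recl !big_ord0 /= !(big_mkcond (fun j : 'I_3 => _ < j)%N)
  !big_ord_recl !big_ord0.
Qed.

Lemma card_base_idx (p : nat) :
  (0 < p)%N -> #|base_idx p| = (p.+2 * p.+1)./2.
Proof.
case: p => // p _; rewrite !card_sum card_prod !card_ord card_edge /ncell.
have -> : (p.+3 * p.+2 = p.-1 * p + (3 + 3 * p).*2)%N by case: p => *; lia.
by rewrite halfD doubleK odd_double andbF add0n addnC.
Qed.

Section Basis.
Variables (R : realType) (p : nat).

Record base_family := BaseFamily {
  vertex_fun : 'I_3 -> {mpoly R[2]};
  edge_fun : edge -> 'I_p.-1 -> {mpoly R[2]};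
  cell_fun : 'I_(ncell p) -> {mpoly R[2]}
}.

Definition base_fun (U : base_family) (b : base_idx p) : {mpoly R[2]} :=
  match b with
  | inl (inl i) => vertex_fun U i
  | inl (inr (e, k)) => edge_fun U e k
  | inr k => cell_fun U k
  end.

(* By card_base_idx, such a family has dim P^p members, so that no separate   *)
(* dimension condition is needed.                                             *)
Record H1_conforming_basis (U : base_family) : Prop := {
  base_fun_deg : forall b, Pspace p (base_fun U b);
  base_fun_indep : lin_indep (base_fun U);
  vertex_fun_vertex : forall i j, i != j ->
    eval (vertex_fun U i) (vertex R j) = 0;
  vertex_fun_edge : forall i e, ~~ neighbour i e ->
    vanishes_on (vertex_fun U i) (on_edge e);
  edge_fun_edge : forall e k e', e' != e ->
    vanishes_on (edge_fun U e k) (on_edge e');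
  cell_fun_edge : forall k e, vanishes_on (cell_fun U k) (on_edge e)
}.

(* Vector fields on the triangle; unlike row vectors of polynomials, finite   *)
(* functions into {mpoly R[2]} form an R-module.                              *)
Definition vfield : lmodType R := {ffun 'I_2 -> {mpoly R[2]}}.

Definition scale_vec (n : {mpoly R[2]}) (l : 'rV[R]_2) : vfield :=
  [ffun k => l 0 k *: n].

Definition nedelec2_space (F : vfield) : Prop := forall k, Pspace p (F k).

Definition vertex_template (i : 'I_3) : 2.-tuple 'rV[R]_2 :=
  tnth [tuple [tuple e1 R; e2 R];
              [tuple e1 R + e2 R; e1 R];
              [tuple e1 R + e2 R; - e2 R]] i.

Definition edge_template (e : edge) : 2.-tuple 'rV[R]_2 :=
  match nat_of_ord (val e).1, nat_of_ord (val e).2 with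
  | 0%N, 1%N => [tuple e2 R; - e1 R]
  | 0%N, 2%N => [tuple e1 R; e2 R]
  | _, _ => [tuple 2^-1 *: (e1 R - e2 R); e1 R + e2 R] (* only (1, 2) is left *)
  end.

Definition cell_template : 2.-tuple 'rV[R]_2 := [tuple e1 R; e2 R].

Definition template (b : base_idx p) : 2.-tuple 'rV[R]_2 :=
  match b with
  | inl (inl i) => vertex_template i
  | inl (inr (e, _)) => edge_template e
  | inr _ => cell_template
  end.

(* The tensor product is the family of all products n l, with n a base        *)
(* function and l in the template of its polytope. Linear independence as an  *)
(* indexed family includes that the union of the parts is direct.             *)
Definition template_tensor (U : base_family) (bk : base_idx p * 'I_2) : vfield :=
  scale_vec (base_fun U bk.1) (tnth (template bk.1) bk.2).

Definition unisolvent_nedelec2 (I : finType) (f : I -> vfield) : Prop :=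
  basis_of nedelec2_space f.

End Basis.

(* Main.v *)
(** In every template the two vectors attached to a polytope are linearly
    independent.  Hence a vanishing combination of the products, read coordinate
    by coordinate, vanishes by the linear independence first of the scalar base
    functions, then of the template vectors.  As the products are at least as many
    as the fields m e_k, with m a monomial of degree at most p, which span the
    Nedelec space, independence implies spanning. *)
Require Import Defs.
From HB Require Import structures.
From mathcomp Require Import all_boot all_order all_algebra.
From mathcomp Require Import boolp reals.
From mathcomp Require Import mpoly ring lra.

Set Implicit Arguments.
Unset Strict Implicit.
Unset Printing Implicit Defensive.

Import GRing.Theory.
Local Open Scope ring_scope.

(** The matrix [A] holds coordinates of [f] with respect to [g]. A left kernel vector of [A] is a
    vanishing combination of [f], so [A] has rank [#|I|]. As [A] has at most that many columns, its
    row space contains every row of coefficients over [g]. *)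
Lemma lin_indep_spans (R : realType) (V : lmodType R) (I J : finType)
    (W : V -> Prop) (f : I -> V) (g : J -> V) :
  (forall i, W (f i)) -> lin_indep f -> spans W g -> (#|J| <= #|I|)%N ->
  spans W f.
Proof.
move=> Wf f_free Wg leJI.
have [a fE] := choice (fun i => Wg _ (Wf i)).
pose A := \matrix_(i < #|I|, j < #|J|) a (enum_val i) (enum_val j).
have combE (u : 'rV[R]_#|I|) : \sum_i u 0 (enum_rank i) *: f i =
    \sum_j (u *m A) 0 (enum_rank j) *: g j.
  under eq_bigr do rewrite fE scaler_sumr.
  rewrite exchange_big /=; apply: eq_bigr => j _.
  rewrite mxE scaler_suml (reindex _ (onW_bij _ (enum_val_bij I))) /=.
  by apply: eq_bigr => i _; rewrite mxE enum_valK enum_rankK scalerA.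
have A_free : row_free A.
  rewrite -kermx_eq0; apply/eqP/row_matrixP => r; rewrite row0.
  set u := row r _; have uA0 : u *m A = 0 by rewrite -row_mul mulmx_ker row0.
  have u0 : \sum_i u 0 (enum_rank i) *: f i = 0.
    by rewrite combE uA0 big1 // => j _; rewrite mxE scale0r.
  by apply/rowP => i; rewrite [RHS]mxE -(enum_valK i) (f_free _ u0).
have A_full : row_full A.
  by rewrite /row_full eqn_leq rank_leq_col (eqP A_free).
move=> v /Wg[w ->].
have /submxP[d wE] := submx_full (\row_j w (enum_val j)) A_full.
exists (fun i => d 0 (enum_rank i)); rewrite combE -wE.
by apply: eq_bigr => j _; rewrite mxE enum_rankK.
Qed.

(** Exponent vectors inject into the [n]-tuples of naturals with sum at most [p], which stars and
    bars counts. *)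
Lemma card_bmultinom_le (n p : nat) : (#|{: 'X_{1..n < p.+1}}| <= 'C(n + p, n))%N.
Proof.
pose h (m : 'X_{1..n < p.+1}) := [tuple inord (m i) : 'I_p.+1 | i < n].
have m_lt (m : 'X_{1..n < p.+1}) i : (m i < p.+1)%N.
  by apply: leq_ltn_trans (bmdeg m); rewrite mdegE (bigD1 i) //= leq_addr.
have h_inj : injective h.
  move=> m1 m2 eq_h; apply/val_inj/mnmP => i.
  have := congr1 (fun t => nat_of_ord (tnth t i)) eq_h.
  by rewrite !tnth_mktuple !inordK.
rewrite -card_partial_ord_partitions -(card_codom h_inj).
apply/subset_leq_card/subsetP => _ /codomP[m ->]; rewrite inE.
rewrite big_tuple (eq_bigr (fun i => m i)) -?mdegE => [|i _]; first exact: bmdeg m.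
by rewrite tnth_mktuple inordK.
Qed.

(** Cramer's rule: the determinant times either coefficient is a combination of the two coordinate
    equations. *)
Lemma lin_indep_pair (R : realType) (v : 'I_2 -> 'rV[R]_2) :
  v 0 0 0 * v 1 0 1 - v 0 0 1 * v 1 0 0 != 0 -> lin_indep v.
Proof.
move=> det_neq0 c /rowP eq0.
have lift1 : lift ord0 ord0 = 1 :> 'I_2 by exact: val_inj.
have E j : c 0 * v 0 0 j + c 1 * v 1 0 j = 0.
  by have := eq0 j; rewrite summxE !big_ord_recl big_ord0 !mxE addr0 lift1.
have c0 : c 0 = 0.
  apply: (mulIf det_neq0); rewrite mul0r.
  transitivity (v 1 0 1 * (c 0 * v 0 0 0 + c 1 * v 1 0 0)
                - v 1 0 0 * (c 0 * v 0 0 1 + c 1 * v 1 0 1)); first by ring.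
  by rewrite !E !mulr0 subr0.
have c1 : c 1 = 0.
  apply: (mulIf det_neq0); rewrite mul0r.
  transitivity (v 0 0 0 * (c 0 * v 0 0 1 + c 1 * v 1 0 1)
                - v 0 0 1 * (c 0 * v 0 0 0 + c 1 * v 1 0 0)); first by ring.
  by rewrite !E !mulr0 subr0.
by case=> [[|[|//]] ?]; [rewrite -c0 | rewrite -c1]; congr c; apply: val_inj.
Qed.

Section Tensor.
Variables (R : realType) (p : nat).

Lemma template_indep (b : base_idx p) : lin_indep (tnth (template R b)).
Proof.
apply: lin_indep_pair; rewrite !(tnth_nth 0).
case: b => [[i | [e k]] | k]; rewrite /template.
- rewrite /vertex_template (tnth_nth [tuple 0; 0]).
  by case: i => [[|[|[|//]]] ?]; rewrite /= /e1 /e2 !mxE /=; apply/eqP; lra.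
- rewrite /edge_template /e1 /e2.
  (* Index pairs that are not edges fall into the default branch of the match, whose determinant is
     1, so all cases close alike. *)
  by case: (nat_of_ord (val e).1) (nat_of_ord (val e).2) => [[|[|[|?]]]|? ?];
    rewrite /= !mxE /=; apply/eqP; lra.
- by rewrite /= /e1 /e2 !mxE /=; apply/eqP; lra.
Qed.

Definition monomial_field (mk : 'X_{1..2 < p.+1} * 'I_2) : vfield R :=
  scale_vec 'X_[mk.1] (delta_mx 0 mk.2).

Lemma monomial_field_spans : spans (@nedelec2_space R p) monomial_field.
Proof.
move=> F degF; exists (fun mk : 'X_{1..2 < p.+1} * 'I_2 => (F mk.2)@_(mk.1)).
apply/ffunP => j; rewrite sum_ffunE {1}(mpolywE (degF j)).
rewrite -(pair_bigA _ (fun (m : 'X_{1..2 < p.+1}) k =>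
  ((F k)@_m *: monomial_field (m, k)) j)) /=.
(* Among the fields built on [m], only the one along the basis vector [j] contributes to component
   [j]. *)
apply: eq_bigr => m _; rewrite (bigD1 j) //= big1 => [|k neq_kj].
  by rewrite !ffunE mxE !eqxx scale1r addr0.
by rewrite !ffunE mxE eq_sym (negPf neq_kj) scale0r scaler0.
Qed.

Variables (U : base_family R p) (hU : H1_conforming_basis U).

Lemma template_tensor_indep : lin_indep (template_tensor U).
Proof.
move=> c /ffunP eq0 [b k].
apply: (template_indep (c := fun k => c (b, k))).
apply/rowP => j; rewrite summxE mxE.
under eq_bigr do rewrite mxE.
(* Component [j] of the vanishing field is a combination of the scalar base functions; its
   coefficient at [b] is coordinate [j] of the template combination at [b]. *)
apply: (base_fun_indep hU
  (c := fun b => \sum_k c (b, k) * tnth (template R b) k 0 j)).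
rewrite -[RHS](ffunE (fun=> 0) j) -[RHS]eq0 sum_ffunE.
under eq_bigr do rewrite scaler_suml.
rewrite pair_bigA; apply: eq_bigr => -[b' k'] _.
by rewrite !ffunE scalerA.
Qed.

Lemma template_tensor_deg bk : nedelec2_space p (template_tensor U bk).
Proof.
move=> k; rewrite /Pspace ffunE; apply: leq_trans (msizeZ_le _ _) _.
exact: base_fun_deg hU _.
Qed.

End Tensor.

Theorem theorem3p1 (R : realType) (p : nat) (hp : (1 <= p)%N)
    (U : base_family R p) (hU : H1_conforming_basis U) :
  unisolvent_nedelec2 p (template_tensor U).
Proof.
have indep := template_tensor_indep hU.
have deg := template_tensor_deg hU.
split=> //; apply: lin_indep_spans deg indep (@monomial_field_spans R p) _.
(* Both index types carry a factor ['I_2]; what remains is the binomial coefficient of [p + 2] over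
   2. *)
rewrite !card_prod leq_mul // card_base_idx //.
by rewrite (leq_trans (card_bmultinom_le 2 p)) ?bin2.
Qed.
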